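(* Let $K$ be a field and let $I\subset S=K[x_1,\ldots,x_n]$ be a (proper) polymatroidal ideal. Then $I$ satisfies the strong persistence property.
   Context: The set of bases of a polymatroid of rank $d$ based on $[n]=\{1,\ldots,n\}$ is a (nonempty) set $\mathcal B\subset\mathbb Z^n$ of integer vectors $\mathbf a=(a(1),\ldots,a(n))$ with non-negative entries such that: (i) $\sum_{i=1}^n a(i)=d$ for all $\mathbf a\in\mathcal B$; (ii) (exchange property) for all $\mathbf a,\mathbf b\in\mathcal B$ and all $i$ with $a(i)>b(i)$ there exists $j\in[n]$ with $b(j)>a(j)$ and $\mathbf a-\epsilon_i+\epsilon_j\in\mathcal B$, where $\epsilon_i$ is the $i$-th canonical unit vector. For a monomial ideal $I$, $G(I)$ denotes its unique minimal set of monomial generators. A monomial ideal $I\subset S$ is polymatroidal if there is a set of bases $\mathcal B\subset \mathbb Z^n$ of a polymatroid with $G(I)=\{\mathbf x^{\mathbf a}: \mathbf a\in\mathcal B\}$, where $\mathbf x^{\mathbf a}=x_1^{a(1)}\cdots x_n^{a(n)}$. Let $R$ be a Noetherian ring and $I\subset R$ a proper ideal. For a prime ideal $P$ containing $I$, let $\mathfrak m_P$ be the maximal ideal of $R_P$ and $I_P=IR_P$. The ideal $I$ satisfies the strong persistence property if for all prime ideals $P\supseteq I$, all integers $k\ge 1$ and all $f\in (I_P^k:\mathfrak m_P)\setminus I_P^k$ there exists $g\in I_P$ such that $fg\notin I_P^{k+1}$. *)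

(* Defs.v *)
From HB Require Import structures.
From mathcomp Require Import all_boot all_order all_algebra ring.
From mathcomp Require Import boolp.
From mathcomp Require Import mpoly.

Set Implicit Arguments.
Unset Strict Implicit.
Unset Printing Implicit Defensive.

Import GRing.Theory.
Local Open Scope ring_scope.
Local Open Scope quotient_scope.

(* Ideals are boolean predicates, as in ring_quotient; Prop-valued conditions  *)
(* are turned into booleans with the classical `[< _ >], so that this is no    *)
(* restriction. The library type idealr R is the type of PROPER ideals of R,   *)
(* and prime_idealr R is the type of (proper) prime ideals of R.               *)

Section IdealOperations.
Variable R : comNzRingType.
Implicit Types I J A : {pred R}.

Definition ideal_gen A : {pred R} :=
  [pred x | `[< exists m (r a : 'I_m -> R),
                 (forall i, a i \in A) /\ x = \sum_(i < m) r i * a i >]].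

Definition ideal_mul I J : {pred R} :=
  ideal_gen [pred x | `[< exists a b, [/\ a \in I, b \in J & x = a * b] >]].

Definition ideal_exp I (k : nat) : {pred R} := iter k (ideal_mul I) predT.

Definition ideal_colon I J : {pred R} :=
  [pred x | `[< forall y, y \in J -> x * y \in I >]].

Lemma ideal_genP A x :
  reflect (exists m (r a : 'I_m -> R),
             (forall i, a i \in A) /\ x = \sum_(i < m) r i * a i)
          (x \in ideal_gen A).
Proof. by rewrite inE; exact: asboolP. Qed.

Lemma mem_ideal_gen A x : x \in A -> x \in ideal_gen A.
Proof.
move=> xA; apply/ideal_genP; exists 1%N, (fun=> 1), (fun=> x); split=> //.
by rewrite big_ord1 mul1r.
Qed.

Lemma ideal_genMl A a x : x \in ideal_gen A -> a * x \in ideal_gen A.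
Proof.
move=> /ideal_genP[m [r [b [bA ->]]]]; apply/ideal_genP.
exists m, (fun i => a * r i), b; split=> //; rewrite mulr_sumr.
by apply: eq_bigr => i _; rewrite mulrA.
Qed.

End IdealOperations.

(* The localization of R at P is the quotient of R x (R \ P) by the relation   *)
(* (a, s) ~ (b, t) <-> u a t = u b s for some u outside P.                     *)

Section LocalizationType.
Variables (R : comNzRingType) (P : prime_idealr R).

Record pre_loc := PreLoc { pl_val :> R * R; _ : pl_val.2 \notin P }.

HB.instance Definition _ := [isSub for pl_val].
HB.instance Definition _ := [Choice of pre_loc by <:].

Definition loc_eq (x y : pre_loc) : bool :=
  `[< exists2 u, u \notin P & u * (x.1 * y.2) = u * (y.1 * x.2) >].

Lemma pl_denP (x : pre_loc) : x.2 \notin P. Proof. by case: x. Qed.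

Lemma notin_primeM (a b : R) : a \notin P -> b \notin P -> a * b \notin P.
Proof. by move=> aP bP; rewrite prime_idealrM negb_or aP. Qed.

Lemma notin_prime1 : (1 : R) \notin P.
Proof. by rewrite idealr1. Qed.

Lemma loc_eqP (x y : pre_loc) :
  reflect (exists2 u, u \notin P & u * (x.1 * y.2) = u * (y.1 * x.2))
          (loc_eq x y).
Proof. exact: asboolP. Qed.

Lemma loc_eq_refl : reflexive loc_eq.
Proof. by move=> x; apply/loc_eqP; exists 1 => //; exact: notin_prime1. Qed.

Lemma loc_eq_sym : ssrbool.symmetric loc_eq.
Proof. by move=> x y; apply/loc_eqP/loc_eqP => -[u uP e]; exists u. Qed.

Lemma loc_eq_trans : transitive loc_eq.
Proof.
move=> y x z /loc_eqP[u uP e] /loc_eqP[v vP e']; apply/loc_eqP.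
exists (u * v * y.2); first by rewrite !notin_primeM ?pl_denP.
transitivity (v * z.2 * (u * (x.1 * y.2))); first by ring.
rewrite e; transitivity (u * x.2 * (v * (y.1 * z.2))); first by ring.
by rewrite e'; ring.
Qed.

Canonical loc_eq_equiv := EquivRel loc_eq loc_eq_refl loc_eq_sym loc_eq_trans.

Definition localization := {eq_quot loc_eq}.

HB.instance Definition _ : EqQuotient _ loc_eq localization :=
  EqQuotient.on localization.
HB.instance Definition _ := Choice.on localization.

Lemma pi_locP (x y : pre_loc) :
  reflect (exists2 u, u \notin P & u * (x.1 * y.2) = u * (y.1 * x.2))
          (\pi_localization x == \pi_localization y).
Proof. by rewrite eqmodE; exact: loc_eqP. Qed.

Definition pl_add (x y : pre_loc) : pre_loc :=
  @PreLoc (x.1 * y.2 + y.1 * x.2, x.2 * y.2)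
          (notin_primeM (pl_denP x) (pl_denP y)).
Definition pl_mul (x y : pre_loc) : pre_loc :=
  @PreLoc (x.1 * y.1, x.2 * y.2) (notin_primeM (pl_denP x) (pl_denP y)).
Definition pl_opp (x : pre_loc) : pre_loc := @PreLoc (- x.1, x.2) (pl_denP x).
Definition pl_of (a : R) : pre_loc := @PreLoc (a, 1) notin_prime1.

Definition loc_add := lift_op2 localization pl_add.
Definition loc_mul := lift_op2 localization pl_mul.
Definition loc_opp := lift_op1 localization pl_opp.

Lemma pi_repr (x : pre_loc) :
  exists2 u, u \notin P & u * ((repr (\pi_localization x)).1 * x.2) =
                          u * (x.1 * (repr (\pi_localization x)).2).
Proof. by apply/pi_locP; rewrite reprK. Qed.

Lemma pi_loc_add : {morph \pi_localization : x y / pl_add x y >-> loc_add x y}.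
Proof.
move=> x y; unlock loc_add; apply/eqP/pi_locP => /=.
have [u uP e] := pi_repr x; have [v vP e'] := pi_repr y.
move: (repr _) e => x' e; move: (repr _) e' => y' e'.
exists (u * v); first exact: notin_primeM.
transitivity (v * y.2 * y'.2 * (u * (x.1 * x'.2)) +
              u * x.2 * x'.2 * (v * (y.1 * y'.2))); first by ring.
by rewrite -e -e'; ring.
Qed.
Canonical pi_loc_add_morph := PiMorph2 pi_loc_add.

Lemma pi_loc_mul : {morph \pi_localization : x y / pl_mul x y >-> loc_mul x y}.
Proof.
move=> x y; unlock loc_mul; apply/eqP/pi_locP => /=.
have [u uP e] := pi_repr x; have [v vP e'] := pi_repr y.
move: (repr _) e => x' e; move: (repr _) e' => y' e'.
exists (u * v); first exact: notin_primeM.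
transitivity ((u * (x.1 * x'.2)) * (v * (y.1 * y'.2))); first by ring.
by rewrite -e -e'; ring.
Qed.
Canonical pi_loc_mul_morph := PiMorph2 pi_loc_mul.

Lemma pi_loc_opp : {morph \pi_localization : x / pl_opp x >-> loc_opp x}.
Proof.
move=> x; unlock loc_opp; apply/eqP/pi_locP => /=.
have [u uP e] := pi_repr x; exists u => //.
by rewrite !mulNr !mulrN e.
Qed.
Canonical pi_loc_opp_morph := PiMorph1 pi_loc_opp.

Definition loc_of : R -> localization := lift_embed localization pl_of.
Canonical loc_of_pi_morph := PiEmbed loc_of.

Lemma pi_loc_eq (x y : pre_loc) :
  x.1 * y.2 = y.1 * x.2 -> \pi_localization x = \pi_localization y.
Proof.
by move=> e; apply/eqP/pi_locP; exists 1; rewrite ?notin_prime1 // e.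
Qed.

Lemma loc_addA : associative loc_add.
Proof.
elim/quotW=> x; elim/quotW=> y; elim/quotW=> z; rewrite !piE.
by apply: pi_loc_eq => /=; ring.
Qed.

Lemma loc_addC : commutative loc_add.
Proof.
by elim/quotW=> x; elim/quotW=> y; rewrite !piE; apply: pi_loc_eq => /=; ring.
Qed.

Lemma loc_add0 : left_id (loc_of 0) loc_add.
Proof. by elim/quotW=> x; rewrite !piE; apply: pi_loc_eq => /=; ring. Qed.

Lemma loc_addN : left_inverse (loc_of 0) loc_opp loc_add.
Proof. by elim/quotW=> x; rewrite !piE; apply: pi_loc_eq => /=; ring. Qed.

HB.instance Definition _ :=
  GRing.isZmodule.Build localization loc_addA loc_addC loc_add0 loc_addN.

Lemma loc_mulA : associative loc_mul.
Proof.
elim/quotW=> x; elim/quotW=> y; elim/quotW=> z; rewrite !piE.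
by apply: pi_loc_eq => /=; ring.
Qed.

Lemma loc_mulC : commutative loc_mul.
Proof.
by elim/quotW=> x; elim/quotW=> y; rewrite !piE; apply: pi_loc_eq => /=; ring.
Qed.

Lemma loc_mul1 : left_id (loc_of 1) loc_mul.
Proof. by elim/quotW=> x; rewrite !piE; apply: pi_loc_eq => /=; ring. Qed.

Lemma loc_mulDl : left_distributive loc_mul loc_add.
Proof.
elim/quotW=> x; elim/quotW=> y; elim/quotW=> z; rewrite !piE.
by apply: pi_loc_eq => /=; ring.
Qed.

Lemma loc_1neq0 : loc_of 1 != loc_of 0.
Proof.
rewrite !piE; apply/loc_eqP => /= -[u uP].
by rewrite mul0r !mulr1 mulr0 => u0; rewrite u0 idealr0 in uP.
Qed.

HB.instance Definition _ :=
  GRing.Zmodule_isComNzRing.Build localization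
    loc_mulA loc_mulC loc_mul1 loc_mulDl loc_1neq0.

Lemma loc_of_is_zmod_morphism : zmod_morphism loc_of.
Proof.
move=> a b; rewrite -[RHS]/(loc_add (loc_of a) (loc_opp (loc_of b))) !piE.
by apply: pi_loc_eq => /=; ring.
Qed.

Lemma loc_of_is_monoid_morphism : monoid_morphism loc_of.
Proof.
split=> // a b; rewrite -[RHS]/(loc_mul _ _) !piE.
by apply: pi_loc_eq => /=; ring.
Qed.

HB.instance Definition _ :=
  GRing.isZmodMorphism.Build R localization loc_of loc_of_is_zmod_morphism.
HB.instance Definition _ :=
  GRing.isMonoidMorphism.Build R localization loc_of loc_of_is_monoid_morphism.

End LocalizationType.

Section LocalizationTheory.
Variables (R : comNzRingType) (P : prime_idealr R).
Local Notation RP := (localization P).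
Local Notation loc_of := (@loc_of R P).

Lemma loc_of_eq0 a :
  reflect (exists2 u, u \notin P & u * a = 0) (loc_of a == 0).
Proof.
rewrite -[X in _ == X]/(loc_of 0) !piE; apply: (iffP (loc_eqP _ _)) => /= -[u uP e];
  exists u => //; by move: e; rewrite mulr1 mul0r mulr0.
Qed.

Lemma loc_of_inv s : s \notin P -> exists y : RP, loc_of s * y = 1.
Proof.
move=> sP; exists (\pi_RP (@PreLoc R P (1, s) sP)).
rewrite -[_ * _]/(loc_mul _ _) -[1 in RHS]/(loc_of 1) !piE.
by apply: pi_loc_eq => /=; ring.
Qed.

Lemma loc_surj (x : RP) :
  exists a s, s \notin P /\ x * loc_of s = loc_of a.
Proof.
elim/quotW: x => x; exists x.1, x.2; split; first exact: pl_denP.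
rewrite -[_ * _]/(loc_mul _ _) !piE.
by apply: pi_loc_eq => /=; ring.
Qed.

Definition loc_ideal (I : {pred R}) : {pred RP} :=
  ideal_gen [pred x | `[< exists2 a, a \in I & x = loc_of a >]].

Definition loc_max : {pred RP} := loc_ideal P.

Lemma loc_idealP (I : idealr R) (x : RP) :
  reflect (exists a s, [/\ a \in I, s \notin P & x * loc_of s = loc_of a])
          (x \in loc_ideal I).
Proof.
apply: (iffP (ideal_genP _ _)) => [[m [r [b [bI ->]]]]|[a [s [aI sP e]]]].
  elim: m r b bI => [|m IHm] r b bI.
    exists 0, 1; rewrite big_ord0 mul0r rmorph0 idealr0.
    by split; rewrite ?notin_prime1.
  rewrite big_ord_recl; set S := \sum_(i < m) _.
  have [a [s [aI sP e]]] :
      exists a s, [/\ a \in I, s \notin P & S * loc_of s = loc_of a].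
    exact: (IHm (fun i => r (lift ord0 i)) (fun i => b (lift ord0 i))).
  have := bI ord0; rewrite inE => /asboolP[c cI ->].
  have [d [t [tP e']]] := loc_surj (r ord0).
  exists (s * (d * c) + t * a), (t * s); split; last 2 first.
  - exact: notin_primeM.
  - rewrite !rmorphD !rmorphM /= -e -e'; ring.
  by rewrite rpredD ?idealMr.
have [y sy] := loc_of_inv sP.
exists 1%N, (fun=> y), (fun=> loc_of a); split.
  by move=> _; rewrite inE; apply/asboolP; exists a.
by rewrite big_ord1 -e mulrCA [y * _]mulrC sy mulr1.
Qed.

(* loc_max = P RP is the set of non-units of RP, hence its unique maximal ideal. *)
Lemma loc_maxP (x : RP) : (x \notin loc_max) <-> (exists y, x * y = 1).
Proof.
have [a [s [sP e]]] := loc_surj x; have [z sz] := loc_of_inv sP.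
split=> [xm|[y xy]].
  have aP : a \notin P by apply: contra xm => aP; apply/loc_idealP; exists a, s.
  have [y ay] := loc_of_inv aP; exists (loc_of s * y).
  by rewrite mulrA e.
apply/negP => /(ideal_genMl y); rewrite mulrC xy => /loc_idealP[b [t [bP tP]]].
rewrite mul1r => /eqP; rewrite -subr_eq0 -rmorphB => /loc_of_eq0[u uP].
rewrite mulrBr => /eqP; rewrite subr_eq0 => /eqP ut.
by have /negP[] := notin_primeM uP tP; rewrite ut idealMr.
Qed.

End LocalizationTheory.

Arguments loc_of {R} P a.
Arguments loc_ideal {R} P I x.
Arguments loc_max {R} P x.

Definition strong_persistence (R : comNzRingType) (I : idealr R) : Prop :=
  forall P : prime_idealr R, {subset I <= P} ->
  forall k : nat, (0 < k)%N ->
  forall f : localization P,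
    f \in ideal_colon (ideal_exp (loc_ideal P I) k) (loc_max P) ->
    f \notin ideal_exp (loc_ideal P I) k ->
  exists2 g, g \in loc_ideal P I &
             f * g \notin ideal_exp (loc_ideal P I) k.+1.

(* Vectors with non-negative integer entries are multinomials 'X_{1..n}, and   *)
(* mdeg a is the sum of the entries of a. The subtraction below is truncated,  *)
(* which is harmless since 0 <= b i < a i.                                     *)

Definition polymatroid_bases (n d : nat) (B : {pred 'X_{1..n}}) : Prop :=
  [/\ exists a, a \in B,
      {in B, forall a, mdeg a = d}
    & {in B &, forall (a b : 'X_{1..n}) (i : 'I_n), (b i < a i)%N ->
        exists j : 'I_n, (a j < b j)%N /\ (a - U_(i) + U_(j))%MM \in B}].

Section MonomialIdeals.
Variables (n : nat) (K : fieldType).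
Implicit Types (I : {pred {mpoly K[n]}}) (G : {pred 'X_{1..n}}).

Definition monomials G : {pred {mpoly K[n]}} :=
  [pred p | `[< exists2 m, m \in G & p = 'X_[m] >]].

Definition monomial_ideal I : Prop :=
  exists G, I =i ideal_gen (monomials G).

Definition min_monomial_gens I G : Prop :=
  I =i ideal_gen (monomials G) /\
  forall G', {subset G' <= G} -> I =i ideal_gen (monomials G') -> G' =i G.

Definition polymatroidal I : Prop :=
  monomial_ideal I /\
  exists d (B : {pred 'X_{1..n}}),
    polymatroid_bases d B /\ min_monomial_gens I B.

End MonomialIdeals.

(* Main.v *)
(* The heart is the identity I^(k+1) : I = I^k, which, unlike (I^k : m_P),
   passes to localizations at once because I is finitely generated.  It says
   that x^c lies in I^k as soon as every c + a, a in B, dominates a sum of k+1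
   bases.  If c dominated no sum of k bases, take a minimal set T of coordinates
   on which this already fails.  The exchange property, inherited by k-fold
   sums, and minimality of T give x(T) > c(T) for every sum x of k bases, so
   c(T) < k a0(T) where a0 in B has minimal a0(T); then (c + a0)(T) is less
   than (k+1) a0(T), hence c + a0 dominates no sum of k+1 bases. *)

Require Import Defs.
From mathcomp Require Import all_boot all_order all_algebra.
From mathcomp Require Import boolp zify ring.
From mathcomp Require Import mpoly.

Set Implicit Arguments.
Unset Strict Implicit.
Unset Printing Implicit Defensive.

Import GRing.Theory.

Local Open Scope ring_scope.

(** * Exchange property and domination for sums of bases *)

Section Exchange.
Local Open Scope nat_scope.
Variable n : nat.
Implicit Types (a b c x y : 'X_{1..n}) (B C : {pred 'X_{1..n}}).
Implicit Types (i j l : 'I_n) (T : {set 'I_n}).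

Definition exchange_closed B : Prop :=
  {in B &, forall a b i, b i < a i ->
     exists j, a j < b j /\ (a - U_(i) + U_(j))%MM \in B}.

Definition sumset B C : {pred 'X_{1..n}} :=
  [pred x | `[< exists a b, [/\ a \in B, b \in C & x = (a + b)%MM] >]].

Definition sumset_exp B k : {pred 'X_{1..n}} := iter k (sumset B) (pred1 0%MM).

Lemma sumsetP B C x :
  reflect (exists a b, [/\ a \in B, b \in C & x = (a + b)%MM])
          (x \in sumset B C).
Proof. by rewrite inE; exact: asboolP. Qed.

Lemma ltn_sum T (F G : 'I_n -> nat) j :
  j \in T -> {in T, forall l, F l <= G l} -> F j < G j ->
  \sum_(l in T) F l < \sum_(l in T) G l.
Proof.
move=> jT leFG ltFG; rewrite [ltnLHS](bigD1 j) // [ltnRHS](bigD1 j) //=.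
by rewrite -addSn leq_add // leq_sum // => l /andP[/leFG].
Qed.

(** The indicators stand on both sides so that the relation between entries has no truncated
    subtraction and suits [lia]. *)
Lemma exchangeE a i j l :
  0 < a i -> (a - U_(i) + U_(j))%MM l + (i == l) = a l + (j == l).
Proof.
move=> ai; rewrite mnmDE mnmBE !mnm1E.
by case: (i =P l) => [<-|_] /=; lia.
Qed.

(** Termination measure for exchanges: truncation keeps only the positive parts of [b - a]. *)
Definition deficit a b := \sum_(l in [set: 'I_n]) (b l - a l).

(** At [i] the contribution is 0 before and after the exchange; at [j], which differs from [i], it
    drops by one. *)
Lemma deficit_exchange a b i j :
  b i < a i -> a j < b j -> deficit (a - U_(i) + U_(j)) b < deficit a b.
Proof.
move=> ltba ltab; have E l := exchangeE j l (leq_ltn_trans (leq0n _) ltba).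
apply: (@ltn_sum _ _ _ j) => [|l _|]; first by rewrite inE.
  have := E l; have [?|_] := i =P l; have [?|_] := j =P l; subst; lia.
by have := E j; rewrite eqxx; have [?|_] := i =P j; subst; lia.
Qed.

(* Exchanging inside one summand may spoil a coordinate where x already exceeds
   y; repairing it by a further exchange moves the summands closer to those of
   y, so the repairs end. *)
Lemma sumset_exchange_closed B C :
  exchange_closed B -> exchange_closed C -> exchange_closed (sumset B C).
Proof.
move=> exB exC x y /sumsetP[a0 [c0 [a0B c0C ->]]].
move=> /sumsetP[b [d [bB dC ->]]] i; set z := (a0 + c0)%MM => lt_i.
(* Invariant: [a + c] is [z] with one unit moved from [i] to [j]. It starts with [j = i], where
   nothing has moved. *)
suff H N : forall a c j, a \in B -> c \in C -> deficit a b + deficit c d < N ->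
    (forall l, (a + c)%MM l + (i == l) = z l + (j == l)) ->
    exists j, z j < (b + d)%MM j /\ (z - U_(i) + U_(j))%MM \in sumset B C.
  exact: (H _ a0 c0 i a0B c0C (ltnSn _)).
elim: N => // N IHN a c j aB cC ltN E.
have [zj|yz] := ltnP (z j) ((b + d)%MM j).
  exists j; split=> //; apply/sumsetP; exists a, c; split=> //.
  apply/mnmP => l; have := E l.
  by have := exchangeE j l (leq_ltn_trans (leq0n _) lt_i); lia.
(* The excess at [j] comes from the unit received or, if [j = i], from [lt_i]; hence one summand
   exceeds its counterpart there. *)
have : (b + d)%MM j < (a + c)%MM j.
  have := E j; rewrite eqxx; have [ij|_] := i =P j; last by lia.
  by move: lt_i; rewrite ij; lia.
rewrite !mnmDE => lt_j.
have [lt_a|le_a] := ltnP (b j) (a j).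
  have [l [ltl a'B]] := exB _ _ aB bB _ lt_a.
  apply: (IHN _ c l a'B cC); first by have := deficit_exchange lt_a ltl; lia.
  move=> m; have := exchangeE l m (leq_ltn_trans (leq0n _) lt_a).
  have := E m; rewrite !mnmDE; clear; lia.
have lt_c : d j < c j by lia.
have [l [ltl c'C]] := exC _ _ cC dC _ lt_c.
apply: (IHN a _ l aB c'C); first by have := deficit_exchange lt_c ltl; lia.
move=> m; have := exchangeE l m (leq_ltn_trans (leq0n _) lt_c).
have := E m; rewrite !mnmDE; clear; lia.
Qed.

Lemma sumset_exp_exchange_closed B k :
  exchange_closed B -> exchange_closed (sumset_exp B k).
Proof.
move=> exB; elim: k => [|k IHk]; last exact: sumset_exchange_closed.
by move=> a b; rewrite !inE => /eqP-> /eqP-> i; rewrite ltnn.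
Qed.

(** For [T = setT] this is membership of x^c in the ideal generated by the x^b; smaller [T] allow a
    minimal choice of coordinates on which domination fails. *)
Definition dominates T B c : Prop :=
  exists2 b, b \in B & {in T, forall l, b l <= c l}.

(* Among the x in B with x(T) <= c(T), the one exceeding c least would be
   below c on T. *)
Lemma sum_gt_of_minimal_undominated T B c :
  exchange_closed B -> ~ dominates T B c ->
  {in T, forall l, dominates (T :\ l) B c} ->
  forall x, x \in B -> \sum_(l in T) c l < \sum_(l in T) x l.
Proof.
move=> exB undom dom x xB; rewrite ltnNge; apply/negP.
have [N] := ubnP (\sum_(l in T) (x l - c l)).
elim: N x xB => // N IHN x xB ltN le_xc.
have [j jT lt_cx] : exists2 j, j \in T & c j < x j.
  apply: contrapT => H; apply: undom; exists x => // l lT.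
  by rewrite leqNgt; apply/negP => ?; apply: H; exists l.
have [l lT lt_xc] : exists2 l, l \in T & x l < c l.
  apply: contrapT => H; suff: \sum_(l in T) c l < \sum_(l in T) x l by lia.
  apply: (ltn_sum jT) => // l lT.
  by rewrite leqNgt; apply/negP => ?; apply: H; exists l.
(* On [T], [b] can exceed [c] only at [l]; since [j] differs from [l], this gives
   [b j <= c j < x j]. *)
have [b bB le_bc] := dom l lT.
have le_bc' m : m \in T -> m != l -> b m <= c m.
  by move=> mT ml; apply: le_bc; rewrite !inE ml.
have lt_bx : b j < x j.
  by have := le_bc' j jT; case: eqP => [?|_]; [subst; lia|move=> /(_ isT); lia].
have [m [ltm x'B]] := exB _ _ xB bB _ lt_bx.
have E l' := exchangeE m l' (leq_ltn_trans (leq0n _) lt_bx).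
(* The unit gained at [m] creates no new excess over [c]: either [m = l], or [x m < b m <= c m]. *)
have mc : m \in T -> x m < c m.
  by move=> mT; have := le_bc' m mT; case: eqP => [->//|_] /(_ isT); lia.
have jm : j != m by apply/eqP => ?; subst; lia.
apply: (IHN _ x'B).
  rewrite ltnS in ltN; apply: leq_trans ltN; apply: (ltn_sum jT).
    move=> p pT; have := E p; have [?|_] := j =P p; have [mp|_] := m =P p;
      subst; try lia.
    by have := mc pT; lia.
  by have := E j; rewrite eqxx eq_sym (negbTE jm); lia.
(* The [T]-sum does not grow: it is unchanged if [m] lies in [T] and drops by one otherwise. *)
have [mT|mT] := boolP (m \in T).
  suff: \sum_(l in T) (x - U_(j) + U_(m))%MM l + 1 = \sum_(l in T) x l + 1.
    by lia.
  have one p : p \in T -> \sum_(l in T) (p == l :> 'I_n) = 1.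
    move=> pT; rewrite (bigD1 p) //= eqxx big1 // => q /andP[_].
    by rewrite eq_sym => /negbTE->.
  rewrite -{1}(one j jT) -(one m mT) -!big_split /=.
  by apply: eq_bigr => p _; exact: E.
apply: leq_trans le_xc; apply: leq_sum => p pT; have := E p.
have [mp|_] := m =P p; last by lia.
by rewrite mp pT in mT.
Qed.

Lemma sumset_exp_colon B k c :
  exchange_closed B -> (exists a, a \in B) ->
  {in B, forall a, dominates setT (sumset_exp B k.+1) (c + a)} ->
  dominates setT (sumset_exp B k) c.
Proof.
move=> exB [a aB] colon; apply: contrapT => undomT.
have [|T] := @ex_minset _ (fun T => `[< ~ dominates T (sumset_exp B k) c >]).
  by exists setT; apply/asboolP.
move=> /minsetP[/asboolP undom minT].
have dom : {in T, forall l, dominates (T :\ l) (sumset_exp B k) c}.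
  move=> l lT; apply: contrapT => /asboolP/minT/(_ (subD1set T l))/setP/(_ l).
  by rewrite !inE eqxx lT.
have ltc := sum_gt_of_minimal_undominated
  (sumset_exp_exchange_closed exB) undom dom.
pose s x := \sum_(l in T) x l.
(* [B] is an arbitrary predicate, so the minimum is taken over the natural numbers that occur as
   values of [s]. *)
have [a0 a0B amin] : exists2 a0, a0 \in B & {in B, forall a, s a0 <= s a}.
  have exP : exists v, `[< exists2 a, a \in B & s a = v >].
    by exists (s a); apply/asboolP; exists a.
  case: (ex_minnP exP) => v /asboolP[a0 a0B sa0] vmin.
  by exists a0 => // a1 a1B; rewrite sa0 vmin //; apply/asboolP; exists a1.
have sD x y : s (x + y)%MM = s x + s y.
  by rewrite /s -big_split; apply: eq_bigr => l _; rewrite mnmDE.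
have s0 : s 0%MM = 0 by rewrite /s big1 // => l _; rewrite mnm0E.
have les m : forall x, x \in sumset_exp B m -> m * s a0 <= s x.
  elim: m => // m IHm x /sumsetP[b [d [bB /IHm dm ->]]].
  by rewrite sD mulSn leq_add // amin.
(* The [k]-fold sum of [a0] attains the lower bound [les]. *)
have [x xk sx] : exists2 x, x \in sumset_exp B k & s x = k * s a0.
  elim: (k) => [|m [x xm sx]]; first by exists 0%MM; rewrite ?inE.
  exists (a0 + x)%MM; last by rewrite sD sx mulSn.
  by apply/sumsetP; exists a0, x.
have [y yk le_y] := colon a0 a0B.
have : s y <= s (c + a0)%MM by apply: leq_sum => l _; exact: le_y.
have := les _ _ yk; have := ltc x xk; rewrite -/(s c) -/(s x) sx sD mulSn; lia.
Qed.

End Exchange.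

(** * Generated ideals and their products *)

Section IdealGen.
Variable R : comNzRingType.
Implicit Types (A I J : {pred R}) (x y : R).

Lemma ideal_gen0 A : 0 \in ideal_gen A.
Proof.
apply/ideal_genP; exists 0%N, (fun=> 0), (fun=> 0).
by split=> [[]//|]; rewrite big_ord0.
Qed.

Lemma ideal_genD A x y :
  x \in ideal_gen A -> y \in ideal_gen A -> x + y \in ideal_gen A.
Proof.
move=> /ideal_genP[m [r [a [aA ->]]]] /ideal_genP[p [s [b [bA ->]]]].
apply/ideal_genP; exists (m + p)%N.
exists (fun i => match split i with inl j => r j | inr j => s j end).
exists (fun i => match split i with inl j => a j | inr j => b j end).
split=> [i|]; first by case: split.
rewrite big_split_ord /=; congr (_ + _); apply: eq_bigr => i _.
  by rewrite -[lshift _ _]/(unsplit (inl i)) unsplitK.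
by rewrite -[rshift _ _]/(unsplit (inr i)) unsplitK.
Qed.

Lemma ideal_gen_ind A (Q : R -> Prop) :
  Q 0 -> (forall x y, Q x -> Q y -> Q (x + y)) ->
  (forall r a, a \in A -> Q (r * a)) ->
  forall x, x \in ideal_gen A -> Q x.
Proof.
move=> Q0 QD QM x /ideal_genP[m [r [a [aA ->]]]].
by elim/big_ind: _ => // i _; exact: QM.
Qed.

Lemma ideal_gen_sub A J :
  {subset A <= ideal_gen J} -> {subset ideal_gen A <= ideal_gen J}.
Proof.
move=> sAJ; apply: ideal_gen_ind => [|x y xJ yJ|r a /sAJ].
- exact: ideal_gen0.
- exact: ideal_genD.
exact: ideal_genMl.
Qed.

Lemma mem_ideal_mul I J x y : x \in I -> y \in J -> x * y \in ideal_mul I J.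
Proof.
by move=> xI yJ; apply: mem_ideal_gen; rewrite inE; apply/asboolP; exists x, y.
Qed.

(** Multiplication is bilinear, so each factor can be expanded in its generators separately. *)
Lemma ideal_mul_gen A J :
  ideal_mul (ideal_gen A) (ideal_gen J) =i
  ideal_gen [pred x | `[< exists a b, [/\ a \in A, b \in J & x = a * b] >]].
Proof.
move=> x; apply/idP/idP; apply: ideal_gen_sub => {}x.
  rewrite inE => /asboolP[a [b [aA bJ ->]]].
  move: a aA; apply: ideal_gen_ind => [|a1 a2|r a aA].
  - by rewrite mul0r ideal_gen0.
  - by rewrite mulrDl; exact: ideal_genD.
  move: b bJ; apply: ideal_gen_ind => [|b1 b2|s b bJ].
  - by rewrite mulr0 ideal_gen0.
  - by rewrite mulrDr; exact: ideal_genD.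
  rewrite mulrACA; apply/ideal_genMl/mem_ideal_gen; rewrite inE.
  by apply/asboolP; exists a, b.
rewrite inE => /asboolP[a [b [aA bJ ->]]].
by apply: mem_ideal_mul; exact: mem_ideal_gen.
Qed.

Lemma eq_ideal_gen A J : A =i J -> ideal_gen A =i ideal_gen J.
Proof.
by move=> eqAJ x; apply/idP/idP; apply: ideal_gen_sub => {}x xA;
  apply: mem_ideal_gen; rewrite ?eqAJ // -eqAJ.
Qed.

Lemma eq_ideal_mul I I' J J' :
  I =i I' -> J =i J' -> ideal_mul I J =i ideal_mul I' J'.
Proof.
move=> eI eJ; apply: eq_ideal_gen => x; rewrite !inE.
by apply: asbool_equiv_eq; split=> -[a [b [aI bJ ->]]]; exists a, b;
  rewrite ?eI ?eJ // -?eI -?eJ.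
Qed.

End IdealGen.

(** * Powers of monomial ideals through exponents *)

Section MonomialPowers.
Variables (n : nat) (K : fieldType).
Implicit Types (I : {pred {mpoly K[n]}}) (B : {pred 'X_{1..n}}).
Implicit Types (p : {mpoly K[n]}).

Lemma monomialsP B p :
  reflect (exists2 m, m \in B & p = 'X_[m]) (p \in @monomials n K B).
Proof. by rewrite inE; exact: asboolP. Qed.

Lemma mem_monomials B m : m \in B -> 'X_[m] \in @monomials n K B.
Proof. by move=> mB; apply/monomialsP; exists m. Qed.

Lemma msuppMXP p m b :
  reflect (exists2 c, c \in msupp p & m = (b + c)%MM)
          (m \in msupp (p * 'X_[b])).
Proof. by rewrite (perm_mem (msuppMX p b)); exact: mapP. Qed.

(** The support of a sum lies in the union of the supports, and conversely [p] is the sum of its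
    terms, so membership is decided term by term. *)
Lemma ideal_gen_monomialsP B p :
  p \in ideal_gen (@monomials n K B) <->
  {in msupp p, forall m, dominates setT B m}.
Proof.
split=> [|dom].
  move: p; apply: ideal_gen_ind => [|p q domp domq|r _ /monomialsP[b bB ->]] m.
  - by rewrite msupp0.
  - by move=> /msuppD_le; rewrite mem_cat => /orP[/domp|/domq].
  move=> /msuppMXP[c _ ->].
  by exists b => // l _; rewrite mnmDE leq_addr.
rewrite (mpolyE p) big_seq; elim/big_ind: _ => [|q r|m mp].
- exact: ideal_gen0.
- exact: ideal_genD.
have [b bB le_bm] := dom m mp.
have /submK<- : (b <= m)%MM by apply/mnm_lepP => l; rewrite le_bm ?inE.
by rewrite mpolyXD scalerAl; apply/ideal_genMl/mem_ideal_gen/mem_monomials.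
Qed.

Lemma ideal_exp_monomials I B k :
  I =i ideal_gen (@monomials n K B) ->
  ideal_exp I k =i ideal_gen (@monomials n K (sumset_exp B k)).
Proof.
move=> IB; elim: k => [|k IHk] p.
  (* The only empty sum is the zero vector, and x^0 = 1 generates the whole ring, the zeroth
     power. *)
  rewrite /= -[p]mulr1 -mpolyX0; apply/esym.
  by apply/ideal_genMl/mem_ideal_gen/mem_monomials; rewrite inE.
rewrite (eq_ideal_mul IB IHk) ideal_mul_gen; apply: eq_ideal_gen => {}p.
rewrite [LHS]inE; apply/asboolP/monomialsP.
  move=> [_ [_ [/monomialsP[a aB ->] /monomialsP[b bB ->] ->]]].
  by exists (a + b)%MM; rewrite ?mpolyXD //; apply/sumsetP; exists a, b.
move=> [_ /sumsetP[a [b [aB bB ->]]] ->].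
by exists 'X_[a], 'X_[b]; rewrite !mem_monomials // mpolyXD.
Qed.

(** Multiplication by a monomial only shifts the support, so the hypothesis splits over the
    exponents of [p]. *)
Lemma monomial_ideal_exp_colon I B k p :
  I =i ideal_gen (@monomials n K B) -> exchange_closed B ->
  (exists a, a \in B) ->
  {in B, forall a, p * 'X_[a] \in ideal_exp I k.+1} -> p \in ideal_exp I k.
Proof.
move=> IB exB B0 colon; rewrite (ideal_exp_monomials k IB).
apply/ideal_gen_monomialsP => m mp; apply: sumset_exp_colon => // a aB.
have := colon a aB; rewrite (ideal_exp_monomials k.+1 IB).
move=> /ideal_gen_monomialsP; apply.
by apply/msuppMXP; exists m; last exact: addmC.
Qed.

End MonomialPowers.

(** * Powers in the localization and clearing denominators *)

Section LocalizedPowers.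
Variables (R : comNzRingType) (P : prime_idealr R).
Implicit Types (A I J : {pred R}).
Local Notation loc := (loc_of P).

Lemma mem_loc_ideal I a : a \in I -> loc a \in loc_ideal P I.
Proof.
by move=> aI; apply: mem_ideal_gen; rewrite inE; apply/asboolP; exists a.
Qed.

Lemma loc_ideal_mul I J :
  loc_ideal P (ideal_mul I J) =i ideal_mul (loc_ideal P I) (loc_ideal P J).
Proof.
move=> x; rewrite ideal_mul_gen; apply/idP/idP; apply: ideal_gen_sub => {}x.
  rewrite inE => /asboolP[a aIJ ->].
  move: a aIJ; apply: ideal_gen_ind => [|a b|r a].
  - by rewrite rmorph0 ideal_gen0.
  - by rewrite rmorphD; exact: ideal_genD.
  rewrite inE => /asboolP[b [c [bI cJ ->]]]; rewrite rmorphM.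
  apply/ideal_genMl/mem_ideal_gen; rewrite inE; apply/asboolP.
  exists (loc b), (loc c); rewrite -rmorphM; split=> //; rewrite inE.
    by apply/asboolP; exists b.
  by apply/asboolP; exists c.
rewrite inE => /asboolP[_ [_ [/asboolP[b bI ->] /asboolP[c cJ ->] ->]]].
by rewrite -rmorphM; apply/mem_loc_ideal/mem_ideal_mul.
Qed.

Lemma loc_ideal_exp I k :
  ideal_exp (loc_ideal P I) k =i loc_ideal P (ideal_exp I k).
Proof.
elim: k => [|k IHk] x; last by rewrite loc_ideal_mul; apply: eq_ideal_mul.
by rewrite /= -[x]mulr1 -(rmorph1 loc) ideal_genMl ?mem_loc_ideal.
Qed.

(* loc_idealP does not apply: it needs a bundled proper ideal. *)
Lemma mem_loc_ideal_gen A x :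
  x \in loc_ideal P (ideal_gen A) ->
  exists a s, [/\ a \in ideal_gen A, s \notin P & x * loc s = loc a].
Proof.
move: x; apply: ideal_gen_ind => [|x y|y _ /asboolP[a aA ->]].
- by exists 0, 1; rewrite mul0r rmorph0 ideal_gen0 notin_prime1.
- move=> [a [s [aA sP ea]]] [b [t [bA tP eb]]].
  exists (t * a + s * b), (s * t); rewrite notin_primeM //; split=> //.
    by rewrite ideal_genD ?ideal_genMl.
  by rewrite !(rmorphD, rmorphM) /= -ea -eb; ring.
have [b [s [sP e]]] := loc_surj y.
exists (b * a), s; split=> //; first exact: ideal_genMl.
by rewrite mulrAC e (rmorphM loc).
Qed.

Lemma loc_ideal_cancel I x s a :
  s \notin P -> a \in I -> x * loc s = loc a -> x \in loc_ideal P I.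
Proof.
move=> sP aI e; have [y sy] := loc_of_inv sP.
by rewrite -[x]mulr1 -sy mulrA e mulrC ideal_genMl ?mem_loc_ideal.
Qed.

(** The relation [a * s = b] holds only in the localization; a further factor [u] outside [P] yields
    it in [R]. *)
Lemma loc_ideal_genE A a :
  loc a \in loc_ideal P (ideal_gen A) ->
  exists2 s, s \notin P & s * a \in ideal_gen A.
Proof.
move=> /mem_loc_ideal_gen[b [s [bA sP e]]].
have : loc (a * s - b) == 0 by rewrite rmorphB rmorphM e subrr.
move=> /loc_of_eq0[u uP]; rewrite mulrBr => /eqP; rewrite subr_eq0 => /eqP e'.
exists (u * s); first exact: notin_primeM.
by rewrite -mulrA [s * a]mulrC e' ideal_genMl.
Qed.

(** Finiteness of [F] enters here: the product of the individual denominators serves every index and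
    stays outside [P]. *)
Lemma loc_ideal_gen_common A a (F : finType) (D : {pred F}) (g : F -> R) :
  {in D, forall i, loc (a * g i) \in loc_ideal P (ideal_gen A)} ->
  exists2 s, s \notin P & {in D, forall i, s * a * g i \in ideal_gen A}.
Proof.
move=> locA.
suff [s sP sA] : exists2 s, s \notin P &
    {in enum F, forall i, i \in D -> s * a * g i \in ideal_gen A}.
  by exists s => // i; apply: sA; rewrite mem_enum.
elim: (enum F) => [|i e [s sP sA]]; first by exists 1; rewrite ?notin_prime1.
have [t tP tA] : exists2 t, t \notin P &
    (i \in D -> t * a * g i \in ideal_gen A).
  have [iD|_] := boolP (i \in D); last by exists 1; rewrite ?notin_prime1.
  by have [t tP tA] := loc_ideal_genE (locA i iD); exists t; rewrite -?mulrA.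
exists (t * s); first exact: notin_primeM.
move=> j; rewrite inE => /predU1P[->|je] jD.
  by rewrite [t * s]mulrC -!mulrA ideal_genMl // mulrA tA.
by rewrite -!mulrA ideal_genMl // mulrA sA.
Qed.

End LocalizedPowers.

(** * Descent to the polynomial ring and conclusion *)

Theorem proposition2p4 (K : fieldType) (n : nat) (I : idealr {mpoly K[n]}) :
  polymatroidal I -> strong_persistence I.
Proof.
move=> [_ [d [B [[B0 Bd exB] [IB _]]]]] P _ k _ f _ fNk.
apply: contrapT => absurd; move/negP: fNk; apply.
have colon g : g \in loc_ideal P I -> f * g \in ideal_exp (loc_ideal P I) k.+1.
  by move=> gI; apply: contrapT => /negP fg; apply: absurd; exists g.
have {absurd} [a [s [sP e]]] := loc_surj f.
pose Bk m := @monomials n K (sumset_exp B m).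
(* Presents the powers in the form [ideal_gen], for which [loc_ideal_gen_common] is stated. *)
have eqk m x : x \in loc_ideal P (ideal_exp I m) =
               (x \in loc_ideal P (ideal_gen (Bk m))).
  apply: eq_ideal_gen => y; rewrite !inE; apply: asbool_equiv_eq.
  by split=> -[b bI ->]; exists b => //; rewrite ?(ideal_exp_monomials m IB) //
    -(ideal_exp_monomials m IB).
(* All bases have degree [d], so the finite type of multinomials of degree below [d.+1] contains
   them all. *)
have [|w wP wI] := @loc_ideal_gen_common _ P (Bk k.+1) a 'X_{1..n < d.+1}
    [pred m | bmnm m \in B] (fun m => 'X_[bmnm m]).
  move=> m mB; rewrite -eqk -loc_ideal_exp.
  have -> : loc_of P (a * 'X_[bmnm m]) =
            loc_of P s * (f * loc_of P 'X_[bmnm m]).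
    by rewrite mulrA [_ * f]mulrC e (rmorphM (loc_of P)).
  apply/ideal_genMl/colon/mem_loc_ideal.
  by rewrite IB mem_ideal_gen ?mem_monomials.
(* With denominator [w * s] the numerator of [f] becomes [w * a], to which the colon identity in the
   polynomial ring applies. *)
rewrite loc_ideal_exp; apply: (@loc_ideal_cancel _ _ _ _ (w * s) (w * a)).
- exact: notin_primeM.
- apply: (monomial_ideal_exp_colon IB exB B0) => b bB.
  rewrite (ideal_exp_monomials k.+1 IB).
  have b_lt : (mdeg b < d.+1)%N by rewrite Bd.
  exact: (wI (BMultinom b_lt)).
by rewrite !(rmorphM (loc_of P)) mulrCA e.
Qed.
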